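(* Let $\widehat R(x)$ be a $k\times p$ matrix of LODOs with coefficients depending only on $x$, with $k\le p$. Then $\widehat R(x)$ is non-invertible if and only if it has a nontrivial kernel, i.e. there is a column $\mathring\varphi=(\varphi_1(x),\dots,\varphi_p(x))^t\ne0$ of smooth functions with $\widehat R(x)\mathring\varphi(x)=0$.
   Context: $D=d/dx$; a LODO $R(x)=\sum_i r_i(x)D^i$ has coefficients depending only on $x$ (from a differential field of functions). An operator matrix $\widehat R$ of size $k\times p$ is invertible if there is a $p\times k$ operator matrix $\widehat S$ with $\widehat R\widehat S$ and $\widehat S\widehat R$ equal to the identity matrices (of sizes $k$ and $p$). *)

(* Defs.v *)
From HB Require Import structures.
From mathcomp Require Import all_boot all_order all_algebra.
Set Implicit Arguments. Unset Strict Implicit. Unset Printing Implicit Defensive.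
Import Order.TTheory GRing.Theory.
Local Open Scope ring_scope.

(* A LODO  R = sum_i r_i D^i  over a differential field (K, dK) is represented
   by the polynomial  sum_i r_i 'X^i : {poly K}  (coefficient list; 'X stands
   for D).  Addition of operators is polynomial addition; composition is the
   Ore product below, NOT polynomial multiplication. *)

(* Composition:  (sum_i a_i D^i) o (sum_j b_j D^j)
     = sum_{i,j} sum_{l<=i} a_i * C(i,l) * dK^l(b_j) D^(i-l+j)
   (Leibniz rule  D^i b = sum_{l<=i} C(i,l) b^(l) D^(i-l)). *)
Definition lodo_mul (K : fieldType) (dK : K -> K) (P Q : {poly K}) : {poly K} :=
  \sum_(i < size P) \sum_(j < size Q) \sum_(l < i.+1)
     (P`_i * ('C(i, l))%:R * iter l dK Q`_j) *: 'X^(i - l + j).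

Definition opmx_mul (K : fieldType) (dK : K -> K) (k p q : nat)
  (R : 'M[{poly K}]_(k, p)) (S : 'M[{poly K}]_(p, q)) : 'M[{poly K}]_(k, q) :=
  \matrix_(i < k, j < q) \sum_(l < p) lodo_mul dK (R i l) (S l j).

Definition opmx_invertible (K : fieldType) (dK : K -> K) (k p : nat)
  (R : 'M[{poly K}]_(k, p)) : Prop :=
  exists S : 'M[{poly K}]_(p, k),
    opmx_mul dK R S = 1%:M /\ opmx_mul dK S R = 1%:M.

Definition lodo_act (K : fieldType) (F : lmodType K) (dF : F -> F)
  (P : {poly K}) (f : F) : F :=
  \sum_(i < size P) P`_i *: iter i dF f.

Definition opmx_act (K : fieldType) (F : lmodType K) (dF : F -> F) (k p : nat)
  (R : 'M[{poly K}]_(k, p)) (phi : 'cV[F]_p) : 'cV[F]_k :=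
  \col_(i < k) \sum_(j < p) lodo_act dF (R i j) (phi j 0).

(* Main.v *)
Require Import Defs.
From HB Require Import structures.
From mathcomp Require Import all_boot all_order all_algebra fingroup perm.
Set Implicit Arguments. Unset Strict Implicit. Unset Printing Implicit Defensive.
Import GRing.Theory.
Local Open Scope ring_scope.

(* Operators are polynomials in D; their composition lodo_mul makes the
   additive group of {poly K} into the Ore ring  ore D = K[D; d].  The ring
   axioms come from letting operators act on themselves (D acts by
   Q |-> 'X Q + Q'): since the action of a composite is the composite of the
   actions (the Leibniz rule), associativity is inherited from composition of
   maps.  Division by leading terms in ore D lets invertible column operations
   reduce any row to (g, 0, ..., 0).  By induction on n, a square operator
   matrix M is then invertible or has a kernel: writing M U = [g 0; a M2],
   a kernel of M2 is a kernel of M U, and if M2 is invertible then either g is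
   a nonzero constant and M U is invertible, or g u = 0 for some u != 0 and
   (u, -M2^-1 a u) is a kernel vector.  A non-square R is padded by zero rows
   to a non-invertible square matrix with the same kernel.  Conversely a
   kernel vector obstructs any left inverse. *)

(* A derivation of K, packaged as a record so that the operator ring below can
   be indexed by it. *)
Record der (K : fieldType) := Der {
  dd : K -> K;
  dd_add : forall a b, dd (a + b) = dd a + dd b;
  dd_mul : forall a b, dd (a * b) = dd a * b + a * dd b }.

Section AdditiveIterates.
Variables (V : zmodType) (d : V -> V).
Hypothesis d_add : forall f g, d (f + g) = d f + d g.

Lemma iterd_add n f g : iter n d (f + g) = iter n d f + iter n d g.
Proof. by elim: n => //= n ->; rewrite d_add. Qed.

Lemma iterd0 n : iter n d 0 = 0.
Proof. by apply: (addrI (iter n d 0)); rewrite -iterd_add !addr0. Qed.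

Lemma iterd_sum n (I : Type) (r : seq I) (P : pred I) (E : I -> V) :
  iter n d (\sum_(i <- r | P i) E i) = \sum_(i <- r | P i) iter n d (E i).
Proof. exact: (big_morph _ (iterd_add n) (iterd0 n)). Qed.

Lemma iterd_muln n m f : iter n d (f *+ m) = iter n d f *+ m.
Proof. by elim: m => [|m IH]; rewrite ?mulr0n ?iterd0 // !mulrS iterd_add IH. Qed.

End AdditiveIterates.

Section DifferentialModule.
Variables (K : fieldType) (D : der K) (F : lmodType K) (dF : F -> F).
Hypothesis dF_add : forall f g, dF (f + g) = dF f + dF g.
Hypothesis dF_scale : forall (a : K) f, dF (a *: f) = dd D a *: f + a *: dF f.

Lemma leibniz n (b : K) (g : F) :
  iter n dF (b *: g) =
  \sum_(l < n.+1) (iter l (dd D) b *: iter (n - l) dF g) *+ 'C(n, l).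
Proof.
have dF_muln f m : dF (f *+ m) = dF f *+ m by exact: (iterd_muln dF_add 1).
elim: n => [|n IH]; first by rewrite big_ord1 /= bin0 mulr1n.
rewrite [LHS]/= IH (big_morph _ dF_add (iterd0 dF_add 1)).
under eq_bigr => l _ do rewrite dF_muln dF_scale mulrnDl.
rewrite big_split /= [in RHS]big_ord_recl /= bin0 mulr1n.
under [in RHS]eq_bigr => l _ do rewrite /bump /= add1n subSS binS mulrnDr.
rewrite big_split /= addrA [LHS]addrC; congr (_ + _).
rewrite [in LHS]big_ord_recl /= bin0 mulr1n subn0; congr (_ + _).
rewrite [in RHS]big_ord_recr /= bin_small // mulr0n addr0.
by apply: eq_bigr => l _; rewrite /bump /= add1n -[in RHS](subnSK (ltn_ord l)).
Qed.

End DifferentialModule.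

Section OperatorAction.
Variables (K : fieldType) (F : lmodType K) (dF : F -> F).
Hypothesis dF_add : forall f g, dF (f + g) = dF f + dF g.

Lemma lodo_act_widen (P : {poly K}) f N : (size P <= N)%N ->
  lodo_act dF P f = \sum_(i < N) P`_i *: iter i dF f.
Proof.
move=> hN; rewrite /lodo_act (big_ord_widen N (fun i => P`_i *: iter i dF f) hN).
rewrite big_mkcond; apply: eq_bigr => i _; case: ifP => // /negbT.
by rewrite -leqNgt => h; rewrite nth_default // scale0r.
Qed.

Lemma lodo_actDl (P Q : {poly K}) f :
  lodo_act dF (P + Q) f = lodo_act dF P f + lodo_act dF Q f.
Proof.
rewrite !(@lodo_act_widen _ _ (maxn (size P) (size Q))) ?leq_maxl ?leq_maxr ?size_polyD //.
by rewrite -big_split; apply: eq_bigr => i _; rewrite coefD scalerDl.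
Qed.

Lemma lodo_act0l f : lodo_act dF 0 f = 0.
Proof. by rewrite /lodo_act size_poly0 big_ord0. Qed.

Lemma lodo_act_suml f (I : Type) (r : seq I) (Pr : pred I) (E : I -> {poly K}) :
  lodo_act dF (\sum_(i <- r | Pr i) E i) f = \sum_(i <- r | Pr i) lodo_act dF (E i) f.
Proof. exact: (big_morph (lodo_act dF ^~ f) (fun P Q => lodo_actDl P Q f) (lodo_act0l f)). Qed.

Lemma lodo_act_monomial (c : K) m f : lodo_act dF (c *: 'X^m) f = c *: iter m dF f.
Proof.
rewrite (@lodo_act_widen _ _ m.+1); last first.
  by rewrite (leq_trans (size_scale_leq _ _)) // size_polyXn.
rewrite big_ord_recr /= big1 ?add0r; first by rewrite coefZ coefXn eqxx mulr1.
by move=> i _; rewrite coefZ coefXn ltn_eqF // mulr0 scale0r.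
Qed.

Lemma lodo_actDr (P : {poly K}) f g :
  lodo_act dF P (f + g) = lodo_act dF P f + lodo_act dF P g.
Proof.
by rewrite /lodo_act -big_split; apply: eq_bigr => i _; rewrite iterd_add // scalerDr.
Qed.

Lemma lodo_act0r (P : {poly K}) : lodo_act dF P 0 = 0.
Proof. by rewrite /lodo_act big1 // => i _; rewrite iterd0 // scaler0. Qed.

Lemma lodo_act_sumr (P : {poly K}) (I : Type) (r : seq I) (Pr : pred I) (E : I -> F) :
  lodo_act dF P (\sum_(i <- r | Pr i) E i) = \sum_(i <- r | Pr i) lodo_act dF P (E i).
Proof. exact: (big_morph _ (lodo_actDr P) (lodo_act0r P)). Qed.

Variable D : der K.
Hypothesis dF_scale : forall (a : K) f, dF (a *: f) = dd D a *: f + a *: dF f.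

(* The composition lodo_mul acts as the composite of the actions: this is where
   the Leibniz rule enters. *)
Lemma lodo_act_mul (P Q : {poly K}) f :
  lodo_act dF (lodo_mul (dd D) P Q) f = lodo_act dF P (lodo_act dF Q f).
Proof.
rewrite /lodo_mul lodo_act_suml [in RHS]/lodo_act; apply: eq_bigr => i _.
rewrite lodo_act_suml iterd_sum // scaler_sumr; apply: eq_bigr => j _.
rewrite lodo_act_suml (leibniz dF_add dF_scale) scaler_sumr; apply: eq_bigr => l _.
by rewrite lodo_act_monomial -scaler_nat !scalerA -iterD mulrA.
Qed.

End OperatorAction.

Section OperatorsActOnOperators.
Variables (K : fieldType) (D : der K).

Lemma dd0 : dd D 0 = 0.
Proof. by apply: (addrI (dd D 0)); rewrite -dd_add !addr0. Qed.

Lemma dd1 : dd D 1 = 0.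
Proof.
have h := dd_mul D 1 1; rewrite !mul1r mulr1 in h.
by apply: (addrI (dd D 1)); rewrite -h addr0.
Qed.

Definition coef_der (Q : {poly K}) : {poly K} := \poly_(i < size Q) dd D Q`_i.

Lemma coef_coef_der Q j : (coef_der Q)`_j = dd D Q`_j.
Proof.
rewrite /coef_der coef_poly; case: ifP => // /negbT; rewrite -leqNgt => h.
by rewrite nth_default // dd0.
Qed.

(* Left composition by D:  D o Q = 'X Q + Q', turning {poly K} itself into a
   differential module. *)
Definition Dcomp (Q : {poly K}) : {poly K} := 'X * Q + coef_der Q.

Lemma Dcomp_add P Q : Dcomp (P + Q) = Dcomp P + Dcomp Q.
Proof.
apply/polyP => j; rewrite !coefD !coef_coef_der !coefXM !coefD dd_add.
by case: ifP => _; rewrite ?add0r // addrACA.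
Qed.

Lemma Dcomp_scale (a : K) (Q : {poly K}) : Dcomp (a *: Q) = dd D a *: Q + a *: Dcomp Q.
Proof.
apply/polyP => j; rewrite !coefD !coefZ !coefD !coef_coef_der !coefXM !coefZ dd_mul.
by rewrite mulrDr; case: ifP => _; rewrite ?mulr0 ?add0r // addrCA.
Qed.

Lemma iter_Dcomp1 i : iter i Dcomp 1 = 'X^i.
Proof.
elim: i => [|i IH] //=; rewrite IH /Dcomp exprS.
suff -> : coef_der 'X^i = 0 by rewrite addr0.
apply/polyP => j; rewrite coef_coef_der coefXn coef0.
by case: (j == i); rewrite /= ?dd1 ?dd0.
Qed.

Lemma lodo_act_Dcomp1 (P : {poly K}) : lodo_act Dcomp P 1 = P.
Proof.
rewrite /lodo_act -[RHS]coefK poly_def; apply: eq_bigr => i _.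
by rewrite iter_Dcomp1.
Qed.

Lemma lodo_mulE (P Q : {poly K}) : lodo_mul (dd D) P Q = lodo_act Dcomp P Q.
Proof.
have := lodo_act_mul Dcomp_add Dcomp_scale P Q 1.
by rewrite !lodo_act_Dcomp1.
Qed.

End OperatorsActOnOperators.

(* The ring K[D; dd D] of differential operators: the additive group of
   {poly K} with composition as product. *)
Definition ore (K : fieldType) (D : der K) : Type := {poly K}.
HB.instance Definition _ (K : fieldType) (D : der K) := GRing.Zmodule.on (ore D).

Section OreRingAxioms.
Variables (K : fieldType) (D : der K).

Definition ore_mul (P Q : ore D) : ore D := lodo_mul (dd D) P Q.
Definition ore_one : ore D := (1 : {poly K}).

Lemma ore_mulA : associative ore_mul.
Proof.
move=> P Q S; rewrite /ore_mul !lodo_mulE -[lodo_act _ P Q]lodo_mulE.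
by rewrite (lodo_act_mul (@Dcomp_add K D) (@Dcomp_scale K D)).
Qed.

Lemma ore_mul1l : left_id ore_one ore_mul.
Proof.
move=> P; rewrite /ore_mul lodo_mulE /ore_one (@lodo_act_widen _ _ _ _ _ 1) ?size_poly1 //.
by rewrite big_ord1 coef1 eqxx scale1r.
Qed.

Lemma ore_mul1r : right_id ore_one ore_mul.
Proof. by move=> P; rewrite /ore_mul lodo_mulE lodo_act_Dcomp1. Qed.

Lemma ore_mulDl : left_distributive ore_mul +%R.
Proof. by move=> P Q S; rewrite /ore_mul !lodo_mulE lodo_actDl. Qed.

Lemma ore_mulDr : right_distributive ore_mul +%R.
Proof. by move=> P Q S; rewrite /ore_mul !lodo_mulE (lodo_actDr (@Dcomp_add K D)). Qed.

Lemma ore_one_neq0 : ore_one != 0.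
Proof. exact: oner_neq0. Qed.

End OreRingAxioms.

HB.instance Definition _ (K : fieldType) (D : der K) :=
  GRing.Zmodule_isNzRing.Build (ore D) (@ore_mulA K D) (@ore_mul1l K D)
    (@ore_mul1r K D) (@ore_mulDl K D) (@ore_mulDr K D) (@ore_one_neq0 K D).

Lemma ore_mulE (K : fieldType) (D : der K) (P Q : ore D) : P * Q = lodo_mul (dd D) P Q.
Proof. by []. Qed.

Section DivisionByLeadingTerms.
Variables (K : fieldType) (D : der K).
Local Notation Dcomp := (Dcomp D).
Local Notation mul := (lodo_mul (dd D)).

Lemma size_iter_Dcomp (Q : {poly K}) i : Q != 0 ->
  size (iter i Dcomp Q) = (size Q + i)%N /\ lead_coef (iter i Dcomp Q) = lead_coef Q.
Proof.
move=> hQ; elim: i => [|i [IH1 IH2]] /=; first by rewrite addn0.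
have hne : iter i Dcomp Q != 0.
  by rewrite -size_poly_eq0 IH1 addn_eq0 size_poly_eq0 (negbTE hQ).
have hs : size ('X * iter i Dcomp Q) = (size (iter i Dcomp Q)).+1.
  by rewrite mulrC size_mulX.
have hlt : (size (coef_der D (iter i Dcomp Q)) < size ('X * iter i Dcomp Q)%R)%N.
  by rewrite hs ltnS size_poly.
rewrite /Dcomp size_polyDl // lead_coefDl // hs IH1 addnS; split => //.
by rewrite mulrC lead_coefMX.
Qed.

Lemma size_lodo_mul (b Y : {poly K}) : b != 0 -> Y != 0 ->
  size (mul b Y) = (size Y + (size b).-1)%N /\
  lead_coef (mul b Y) = lead_coef b * lead_coef Y.
Proof.
move=> hb hY; rewrite lodo_mulE /lodo_act.
have := polySpred hb; set n := (size b).-1 => hsb.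
rewrite hsb big_ord_recr /=.
have [hs1 hl1] := size_iter_Dcomp n hY.
have hbn : b`_n != 0 by rewrite -lead_coef_eq0 /lead_coef hsb /= in hb.
have hlast : size (b`_n *: iter n Dcomp Y) = (size Y + n)%N by rewrite size_scale.
have hrest : (size (\sum_(i < n) b`_i *: iter i Dcomp Y)%R < size Y + n)%N.
  rewrite (leq_ltn_trans (size_sum _ _ _)) //.
  case: n {hsb hbn hs1 hl1 hlast} => [|n]; first by rewrite big_ord0 addn0 lt0n size_poly_eq0.
  rewrite addnS ltnS; apply/bigmax_leqP => i _.
  rewrite (leq_trans (size_scale_leq _ _)) //.
  by have [-> _] := size_iter_Dcomp i hY; rewrite leq_add2l -ltnS.
rewrite addrC size_polyDl ?hlast // lead_coefDl ?hlast //.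
by rewrite lead_coefZ hl1 /lead_coef hsb.
Qed.

Lemma lodo_mul0r (b : {poly K}) : mul b 0 = 0.
Proof. by rewrite lodo_mulE (lodo_act0r (@Dcomp_add K D)). Qed.

Lemma lodo_mulDr (b p q : {poly K}) : mul b (p + q) = mul b p + mul b q.
Proof. by rewrite !lodo_mulE (lodo_actDr (@Dcomp_add K D)). Qed.

Lemma size_sub_same_lead (a c : {poly K}) : a != 0 -> size c = size a ->
  lead_coef c = lead_coef a -> (size (a - c)%R < size a)%N.
Proof.
move=> ha hs hl; have hsa := polySpred ha.
suff : (size (a - c)%R <= (size a).-1)%N by rewrite {2}hsa ltnS.
apply/leq_sizeP => j hj; rewrite coefB.
case: (ltngtP j (size a).-1) => hj'.
- by move: (leq_ltn_trans hj hj'); rewrite ltnn.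
- by rewrite !nth_default ?subr0 // ?hs hsa.
- by rewrite hj'; move: hl; rewrite /lead_coef hs => ->; rewrite subrr.
Qed.

Lemma lodo_div (b a : {poly K}) : b != 0 ->
  exists q, (size (a - mul b q)%R < size b)%N /\ (size (a - mul b q)%R <= size a)%N.
Proof.
move=> hb; elim: {a}(size a).+1 {-2}a (ltnSn (size a)) => // n IH a ha.
case: (ltnP (size a) (size b)) => hab; first by exists 0; rewrite lodo_mul0r subr0.
have hbs := polySpred hb.
have ha0 : a != 0 by rewrite -size_poly_eq0 -lt0n (leq_trans _ hab) // hbs.
set c := lead_coef a / lead_coef b.
have hc : c != 0 by rewrite mulf_neq0 ?invr_eq0 ?lead_coef_eq0.
set Y := c *: 'X^(size a - size b).
have hY : Y != 0 by rewrite scaler_eq0 negb_or hc /= -size_poly_eq0 size_polyXn.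
have [hs hl] := size_lodo_mul hb hY.
have hsY : size Y = (size a - size b).+1 by rewrite size_scale // size_polyXn.
have hs' : size (mul b Y) = size a by rewrite hs hsY addSn -addnS -hbs subnK.
have hl' : lead_coef (mul b Y) = lead_coef a.
  by rewrite hl lead_coefZ lead_coefXn mulr1 /c mulrC divfK // lead_coef_eq0.
have hlt := size_sub_same_lead ha0 hs' hl'.
have [q' [h1 h2]] := IH (a - mul b Y) (leq_trans hlt ha).
exists (Y + q'); rewrite lodo_mulDr opprD addrA; split => //.
by rewrite (leq_trans h2) // ltnW.
Qed.

End DivisionByLeadingTerms.

Section ConstantOperators.
Variables (K : fieldType) (D : der K).

Definition nzconst (u : ore D) : bool := size (u : {poly K}) == 1%N.

Lemma lodo_mulCl (c : K) (Q : {poly K}) : lodo_mul (dd D) c%:P Q = c *: Q.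
Proof.
rewrite lodo_mulE (@lodo_act_widen _ _ _ _ _ 1) ?size_polyC_leq1 //.
by rewrite big_ord1 coefC eqxx.
Qed.

Lemma nzconst_unit (u : ore D) : nzconst u -> exists v, u * v = 1 /\ v * u = 1.
Proof.
move=> /size_poly1P [c hc ->]; exists (c^-1)%:P.
by rewrite !ore_mulE !lodo_mulCl !scale_polyC mulfV // mulVf.
Qed.

End ConstantOperators.

Section InvertibleMatrices.
Variable R : nzRingType.

(* Two-sided invertibility of a square matrix over a possibly noncommutative
   ring (MathComp's unitmx requires commutativity). *)
Definition invertible_mx n (A : 'M[R]_n) : Prop :=
  exists B : 'M[R]_n, A *m B = 1%:M /\ B *m A = 1%:M.

Lemma invertible_mx1 n : invertible_mx (1%:M : 'M[R]_n).
Proof. by exists 1%:M; rewrite mul1mx. Qed.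

Lemma invertible_mxM n (A B : 'M[R]_n) :
  invertible_mx A -> invertible_mx B -> invertible_mx (A *m B).
Proof.
move=> [A' [hA1 hA2]] [B' [hB1 hB2]]; exists (B' *m A'); split.
  by rewrite mulmxA -(mulmxA A) hB1 mulmx1 hA1.
by rewrite mulmxA -(mulmxA B') hA2 mulmx1 hB2.
Qed.

Lemma invertible_mxKr n (A U : 'M[R]_n) :
  invertible_mx U -> invertible_mx (A *m U) -> invertible_mx A.
Proof.
move=> [U' [hU1 hU2]] [B [hB1 hB2]]; exists (U *m B); split; first by rewrite mulmxA.
by rewrite -[LHS]mulmx1 -hU1 !mulmxA -(mulmxA _ A U) -(mulmxA U B) hB2 mulmx1.
Qed.

Lemma invertible_1addN n (N : 'M[R]_n) : N *m N = 0 -> invertible_mx (1%:M + N).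
Proof.
move=> hN; exists (1%:M - N); split.
  by rewrite mulmxDl !mulmxBr !mul1mx !mulmx1 hN subr0 subrK.
by rewrite mulmxBl !mulmxDr !mul1mx !mulmx1 hN addr0 addrK.
Qed.

Lemma invertible_perm_mx n (s : 'S_n) : invertible_mx (perm_mx s : 'M[R]_n).
Proof. by exists (perm_mx s^-1); rewrite -!perm_mxM mulgV mulVg perm_mx1. Qed.

Lemma invertible_mx_1x1 (A : 'M[R]_1) v :
  A 0 0 * v = 1 -> v * A 0 0 = 1 -> invertible_mx A.
Proof.
move=> hAv hvA; exists v%:M.
by split; apply/matrixP => i j; rewrite !ord1 !mxE big_ord1 !mxE ?mulr1n.
Qed.

Lemma invertible_block_lower m1 m2 (A : 'M[R]_m1) (C : 'M[R]_(m2, m1)) (B : 'M[R]_m2) :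
  invertible_mx A -> invertible_mx B -> invertible_mx (block_mx A 0 C B).
Proof.
move=> [A' [hA1 hA2]] [B' [hB1 hB2]].
exists (block_mx A' 0 (- (B' *m C *m A')) B').
rewrite !mulmx_block !mulmx0 !mul0mx !addr0 !add0r mulmxN !mulmxA hA1 hA2 hB1 hB2.
rewrite mul1mx subrr mulNmx -(mulmxA _ A' A) hA2 mulmx1 addNr.
by rewrite -!scalar_mx_block.
Qed.

End InvertibleMatrices.

Section ColumnOperations.
Variable R : nzRingType.

Definition transvection n (j0 : 'I_n) (w : 'I_n -> R) : 'M[R]_n :=
  1%:M + \matrix_(i, j) (if (i == j0) && (j != j0) then w j else 0).

Lemma transvection_invertible n (j0 : 'I_n) w : invertible_mx (transvection j0 w).
Proof.
apply: invertible_1addN; apply/matrixP => i j; rewrite !mxE big1 // => l _.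
by rewrite !mxE; case: (l =P j0) => [->|_]; rewrite ?eqxx ?andbF ?mul0r ?mulr0.
Qed.

Lemma row_transvection n (j0 : 'I_n) w (r : 'rV[R]_n) j :
  (r *m transvection j0 w) 0 j = r 0 j + (if j != j0 then r 0 j0 * w j else 0).
Proof.
rewrite mulmxDr mulmx1 mxE; congr (_ + _); rewrite mxE (bigD1 j0) //= big1 ?addr0.
  by rewrite mxE eqxx /=; case: ifP; rewrite ?mulr0.
by move=> l hl; rewrite mxE (negbTE hl) mulr0.
Qed.

Lemma row_swap_pivot n (r : 'rV[R]_n.+1) (j0 : 'I_n.+1) :
  (forall j, j != j0 -> r 0 j = 0) ->
  forall j, j != 0 -> (r *m perm_mx (tperm 0 j0)) 0 j = 0.
Proof.
move=> hr j hj; rewrite -[tperm 0 j0]tpermV -col_permE mxE hr //.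
by apply: contraNneq hj => /(congr1 (tperm 0 j0)); rewrite tpermK tpermR => ->.
Qed.

End ColumnOperations.

Lemma ltn_sum_pointwise n (f g : 'I_n -> nat) (j : 'I_n) :
  (forall i, f i <= g i)%N -> (f j < g j)%N -> (\sum_i f i < \sum_i g i)%N.
Proof.
move=> hle hlt; rewrite (bigD1 j) //= [X in (_ < X)%N](bigD1 j) //=.
by rewrite -addSn leq_add // leq_sum.
Qed.

Section RowReduction.
Variables (K : fieldType) (D : der K).

(* Total size of the entries of a row: the measure of the Euclidean algorithm. *)
Definition row_size n (r : 'rV[ore D]_n) : nat :=
  \sum_(j < n) size (r ord0 j : {poly K}).

(* One Euclidean step: dividing every entry by a nonzero entry r_j0 of least
   order strictly lowers the row size, unless r_j0 is the only nonzero entry. *)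
Lemma row_reduce_step n (r : 'rV[ore D]_n) (j0 j1 : 'I_n) :
  r ord0 j0 != 0 ->
  (forall j, r ord0 j != 0 ->
     (size (r ord0 j0 : {poly K}) <= size (r ord0 j : {poly K}))%N) ->
  j1 != j0 -> r ord0 j1 != 0 ->
  exists2 U, invertible_mx U & (row_size (r *m U) < row_size r)%N.
Proof.
move=> hj0 hmin hj1 hr1.
pose rem j q : {poly K} := r ord0 j - lodo_mul (dd D) (r ord0 j0) q.
have [q hq] := fin_all_exists (fun j : 'I_n => lodo_div D (r ord0 j) hj0).
exists (transvection j0 (fun j => - (q j : ore D))); first exact: transvection_invertible.
have hr' j : (r *m transvection j0 (fun j => - (q j : ore D))) 0 j =
             if j != j0 then rem j (q j) else r ord0 j.
  by rewrite row_transvection; case: ifP => _; rewrite ?addr0 // mulrN.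
apply: (@ltn_sum_pointwise _ _ _ j1) => [j|]; rewrite hr'.
  by case: ifP => _ //; case: (hq j).
by rewrite hj1; apply: leq_trans (proj1 (hq j1)) (hmin _ hr1).
Qed.

Lemma row_reduce n (r : 'rV[ore D]_n.+1) :
  exists2 U, invertible_mx U & forall j, j != 0 -> (r *m U) 0 j = 0.
Proof.
elim: {r}(row_size r).+1 {-2}r (ltnSn (row_size r)) => // N IH r hN.
case: (pickP (fun j => r 0 j != 0)) => [j1 hj1 | hzero]; last first.
  exists 1%:M; first exact: invertible_mx1.
  by move=> j _; rewrite mulmx1; apply/eqP; move: (hzero j) => /negbFE.
case: (@arg_minnP _ j1 (fun j => r 0 j != 0) (fun j => size (r 0 j : {poly K})) hj1).
move=> j0 hj0 hmin.
case: (pickP (fun j => (j != j0) && (r 0 j != 0))) => [j /andP [hj hrj] | hlone].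
- have [U hU hlt] := row_reduce_step hj0 hmin hj hrj.
  have [U' hU' hz] := IH (r *m U) (leq_trans hlt hN).
  exists (U *m U'); first exact: invertible_mxM.
  by move=> j' hj'; rewrite mulmxA hz.
- exists (perm_mx (tperm 0 j0)); first exact: invertible_perm_mx.
  apply: row_swap_pivot => j hj; apply/eqP.
  by move: (hlone j); rewrite hj /= => /negbFE.
Qed.

Lemma first_row_reduce n (M : 'M[ore D]_(1 + n)) :
  exists2 U : 'M[ore D]_(1 + n), invertible_mx U & ursubmx (M *m U) = 0.
Proof.
have [U hU hz] := row_reduce (row 0 M).
exists U => //; apply/matrixP => i j; rewrite !mxE (ord1 i).
have -> : lshift n (0 : 'I_1) = 0 by apply: val_inj.
have hne : rshift 1 j != 0 :> 'I_(1 + n) by apply/eqP => /(congr1 val).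
by have := hz _ hne; rewrite -row_mul !mxE.
Qed.

End RowReduction.

Section PaddedMatrices.
Variable R : nzRingType.

(* Completion of a k x p matrix by p - k zero rows to a square matrix. *)
Definition pad_rows k p (A : 'M[R]_(k, p)) : 'M[R]_p :=
  \matrix_(i, j) oapp (fun i' : 'I_k => A i' j) 0 (insub (val i)).

(* A square matrix with a zero row has no right inverse. *)
Lemma pad_rows_not_invertible k p (A : 'M[R]_(k, p)) :
  (k < p)%N -> ~ invertible_mx (pad_rows A).
Proof.
move=> hkp [S [hAS _]]; pose i0 : 'I_p := Ordinal hkp.
have := congr1 (fun B : 'M[R]_p => B i0 i0) hAS; rewrite !mxE big1 ?eqxx.
  by move=> /eqP; rewrite eq_sym oner_eq0.
by move=> l _; rewrite mxE insubF ?ltnn //= mul0r.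
Qed.

End PaddedMatrices.

Lemma opmx_mulE (K : fieldType) (D : der K) k p q (R : 'M[{poly K}]_(k, p))
  (S : 'M[{poly K}]_(p, q)) :
  opmx_mul (dd D) R S = (R : 'M[ore D]_(k, p)) *m (S : 'M[ore D]_(p, q)).
Proof. by apply/matrixP => i j; rewrite !mxE. Qed.

Lemma scalar_mx1_ore (K : fieldType) (D : der K) n :
  (1%:M : 'M[{poly K}]_n) = (1%:M : 'M[ore D]_n).
Proof. by apply/matrixP => i j; rewrite !mxE. Qed.

Lemma opmx_invertible_square (K : fieldType) (D : der K) p (R : 'M[{poly K}]_p) :
  opmx_invertible (dd D) R <-> invertible_mx (R : 'M[ore D]_p).
Proof.
by split=> -[S hS]; exists S; move: hS; rewrite !(opmx_mulE D) (scalar_mx1_ore D).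
Qed.

Section MatrixAction.
Variables (K : fieldType) (D : der K) (F : lmodType K) (dF : F -> F).
Hypothesis dF_add : forall f g, dF (f + g) = dF f + dF g.
Hypothesis dF_scale : forall (a : K) f, dF (a *: f) = dd D a *: f + a *: dF f.

Definition has_kernel m n (M : 'M[ore D]_(m, n)) : Prop :=
  exists2 phi : 'cV[F]_n, phi != 0 & opmx_act dF M phi = 0.

Lemma opmx_act_mul m n p (M : 'M[ore D]_(m, n)) (N : 'M[ore D]_(n, p)) (phi : 'cV[F]_p) :
  opmx_act dF (M *m N) phi = opmx_act dF M (opmx_act dF N phi).
Proof.
apply/matrixP => i z; rewrite !mxE.
under eq_bigr => j _ do rewrite mxE lodo_act_suml.
under [RHS]eq_bigr => l _ do rewrite mxE (lodo_act_sumr dF_add).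
rewrite exchange_big /=; apply: eq_bigr => l _; apply: eq_bigr => j _.
by rewrite ore_mulE (lodo_act_mul dF_add dF_scale).
Qed.

Lemma opmx_act1 n (phi : 'cV[F]_n) : opmx_act dF (1%:M : 'M[ore D]_n) phi = phi.
Proof.
apply/matrixP => i z; rewrite (ord1 z) !mxE (bigD1 i) //= big1 ?addr0.
  rewrite mxE eqxx mulr1n (@lodo_act_widen _ _ _ _ _ 1) ?size_poly1 //.
  by rewrite big_ord1 coef1 eqxx scale1r.
by move=> j hj; rewrite mxE eq_sym (negbTE hj) mulr0n lodo_act0l.
Qed.

Lemma opmx_act0r m n (M : 'M[ore D]_(m, n)) : opmx_act dF M 0 = 0.
Proof.
by apply/matrixP => i z; rewrite !mxE big1 // => j _; rewrite mxE lodo_act0r.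
Qed.

Lemma opmx_act0l m n (phi : 'cV[F]_n) : opmx_act dF (0 : 'M[ore D]_(m, n)) phi = 0.
Proof.
by apply/matrixP => i z; rewrite !mxE big1 // => j _; rewrite mxE lodo_act0l.
Qed.

Lemma opmx_actDl m n (A B : 'M[ore D]_(m, n)) phi :
  opmx_act dF (A + B) phi = opmx_act dF A phi + opmx_act dF B phi.
Proof.
apply/matrixP => i z; rewrite !mxE -big_split /=.
by apply: eq_bigr => j _; rewrite mxE lodo_actDl.
Qed.

Lemma opmx_act_col_mx m1 m2 n (A : 'M[ore D]_(m1, n)) (C : 'M[ore D]_(m2, n)) phi :
  opmx_act dF (col_mx A C) phi = col_mx (opmx_act dF A phi) (opmx_act dF C phi).
Proof.
apply/matrixP => i z; case: (split_ordP i) => i' ->.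
  by rewrite col_mxEu !mxE; apply: eq_bigr => j _; rewrite col_mxEu.
by rewrite col_mxEd !mxE; apply: eq_bigr => j _; rewrite col_mxEd.
Qed.

Lemma opmx_act_row_mx m n1 n2 (A : 'M[ore D]_(m, n1)) (B : 'M[ore D]_(m, n2)) u v :
  opmx_act dF (row_mx A B) (col_mx u v) = opmx_act dF A u + opmx_act dF B v.
Proof.
apply/matrixP => i z; rewrite !mxE big_split_ord /=.
by congr (_ + _); apply: eq_bigr => j _; rewrite ?row_mxEl ?row_mxEr ?col_mxEu ?col_mxEd.
Qed.

Lemma opmx_act_block m1 m2 n1 n2 (A : 'M[ore D]_(m1, n1)) (B : 'M[ore D]_(m1, n2))
  (C : 'M[ore D]_(m2, n1)) (E : 'M[ore D]_(m2, n2)) u v :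
  opmx_act dF (block_mx A B C E) (col_mx u v) =
  col_mx (opmx_act dF A u + opmx_act dF B v) (opmx_act dF C u + opmx_act dF E v).
Proof. by rewrite block_mxEv opmx_act_col_mx !opmx_act_row_mx. Qed.

Lemma kernel_no_left_inverse m n (M : 'M[ore D]_(m, n)) (S : 'M[ore D]_(n, m)) :
  has_kernel M -> S *m M = 1%:M -> False.
Proof.
move=> [phi hphi hM] hSM; move: hphi.
by rewrite -(opmx_act1 phi) -hSM opmx_act_mul hM opmx_act0r eqxx.
Qed.

Lemma kernel_mxKr n (M U : 'M[ore D]_n) :
  invertible_mx U -> has_kernel (M *m U) -> has_kernel M.
Proof.
move=> [U' [hUU' hU'U]] [phi hphi hMU]; exists (opmx_act dF U phi).
  apply: contraNneq hphi => hU0.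
  by rewrite -(opmx_act1 phi) -hU'U opmx_act_mul hU0 opmx_act0r.
by rewrite -opmx_act_mul.
Qed.

Lemma kernel_block_lower m1 m2 (A : 'M[ore D]_m1) (C : 'M[ore D]_(m2, m1))
  (B : 'M[ore D]_m2) :
  has_kernel B -> has_kernel (block_mx A 0 C B).
Proof.
move=> [psi hpsi hBpsi]; exists (col_mx 0 psi).
  by rewrite col_mx_eq0 negb_and hpsi orbT.
by rewrite opmx_act_block hBpsi !opmx_act0r opmx_act0l !addr0 col_mx0.
Qed.

Lemma kernel_block_upper m1 m2 (A : 'M[ore D]_m1) (C : 'M[ore D]_(m2, m1))
  (B : 'M[ore D]_m2) :
  invertible_mx B -> has_kernel A -> has_kernel (block_mx A 0 C B).
Proof.
move=> [B' [hBB' _]] [u hu hAu]; exists (col_mx u (opmx_act dF (- (B' *m C)) u)).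
  by rewrite col_mx_eq0 negb_and hu.
rewrite opmx_act_block hAu opmx_act0l addr0 -opmx_act_mul mulmxN mulmxA hBB' mul1mx.
by rewrite -opmx_actDl subrr opmx_act0l col_mx0.
Qed.

Lemma kernel_pad_rows k p (A : 'M[ore D]_(k, p)) :
  (k <= p)%N -> has_kernel (pad_rows A) -> has_kernel A.
Proof.
move=> hkp [phi hphi hA]; exists phi => //; apply/matrixP => i z.
have := congr1 (fun B : 'cV[F]_p => B (widen_ord hkp i) z) hA.
rewrite !mxE => h; rewrite -[RHS]h.
by apply: eq_bigr => j _; rewrite mxE /= valK.
Qed.

Hypothesis F_rich : forall P : {poly K}, (1 < size P)%N ->
  exists2 f : F, f != 0 & lodo_act dF P f = 0.

Lemma kernel_nonconst (A : 'M[ore D]_1) : ~~ nzconst (A 0 0) -> has_kernel A.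
Proof.
move=> hA.
have [f hf hAf] : exists2 f : F, f != 0 & lodo_act dF (A 0 0) f = 0.
  have [hA0|hA0] := eqVneq (A 0 0) 0.
    have [f hf _] : exists2 f : F, f != 0 & lodo_act dF 'X f = 0.
      by apply: F_rich; rewrite size_polyX.
    by exists f => //; rewrite hA0 lodo_act0l.
  by apply: F_rich; rewrite ltn_neqAle eq_sym hA lt0n size_poly_eq0.
exists (const_mx f).
  by apply: contraNneq hf => /matrixP /(_ 0 0); rewrite !mxE => ->.
by apply/matrixP => i j; rewrite !ord1 !mxE big_ord1 mxE.
Qed.

(* A kernel of M2 gives one directly; if M2 is invertible, either g is
   a nonzero constant and the block matrix is invertible, or g has a kernel. *)
Lemma block_dichotomy n (g : 'M[ore D]_1) (a : 'M[ore D]_(n, 1)) (M2 : 'M[ore D]_n) :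
  invertible_mx M2 \/ has_kernel M2 ->
  invertible_mx (block_mx g 0 a M2) \/ has_kernel (block_mx g 0 a M2).
Proof.
case=> [hM2|hM2]; last by right; exact: kernel_block_lower.
have [hg|hg] := boolP (nzconst (g 0 0)).
- left; apply: invertible_block_lower => //.
  by have [v [h1 h2]] := nzconst_unit hg; exact: invertible_mx_1x1 h1 h2.
- by right; apply: kernel_block_upper => //; exact: kernel_nonconst.
Qed.

(* The dichotomy for square operator matrices, by induction on the size:
   column reduction puts M U in the block form [g 0; a M2]. *)
Lemma square_dichotomy n (M : 'M[ore D]_n) : invertible_mx M \/ has_kernel M.
Proof.
elim: n M => [|n IH] M.
  by left; exists 1%:M; split; apply/matrixP => -[].
have [U hU hM1] := first_row_reduce (M : 'M_(1 + n)).
have := block_dichotomy (ulsubmx (M *m U : 'M_(1 + n))) (dlsubmx (M *m U : 'M_(1 + n)))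
  (IH (drsubmx (M *m U : 'M_(1 + n)))).
rewrite -hM1 submxK => -[hinv|hker].
- by left; exact: invertible_mxKr hU hinv.
- by right; exact: kernel_mxKr hU hker.
Qed.

End MatrixAction.

Theorem lemma2
  (K : fieldType) (dK : K -> K)
  (dK_add : forall a b : K, dK (a + b) = dK a + dK b)
  (dK_mul : forall a b : K, dK (a * b) = dK a * b + a * dK b)
  (F : lmodType K) (dF : F -> F)
  (dF_add : forall f g : F, dF (f + g) = dF f + dF g)
  (dF_scale : forall (a : K) (f : F), dF (a *: f) = dK a *: f + a *: dF f)
  (F_rich : forall P : {poly K}, (1 < size P)%N ->
              exists2 f : F, f != 0 & lodo_act dF P f = 0)
  (k p : nat) (Hkp : (k <= p)%N) (R : 'M[{poly K}]_(k, p)) :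
  ~ opmx_invertible dK R <->
  exists2 phi : 'cV[F]_p, phi != 0 & opmx_act dF R phi = 0.
Proof.
pose D := Der dK_add dK_mul.
have dF_scaleD : forall (a : K) f, dF (a *: f) = dd D a *: f + a *: dF f := dF_scale.
have dichotomy := square_dichotomy dF_add dF_scaleD F_rich.
split; last first.
  move=> hker [S [_ hSR]]; apply: (kernel_no_left_inverse dF_add dF_scaleD (S := S) hker).
  by move: hSR; rewrite (opmx_mulE D) (scalar_mx1_ore D).
move=> hnot; case: (ltngtP k p) => hkp.
- have [hinv|hker] := dichotomy _ (pad_rows (R : 'M[ore D]_(k, p))).
    by case: (pad_rows_not_invertible hkp hinv).
  exact: kernel_pad_rows (ltnW hkp) hker.
- by move: (leq_ltn_trans Hkp hkp); rewrite ltnn.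
- subst k; have [hinv|hker] := dichotomy _ (R : 'M[ore D]_p) => //.
  by case: hnot; apply/(opmx_invertible_square D).
Qed.
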